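(* Let $\mathcal{H}_A,\mathcal{H}_B$ be complex Hilbert spaces of finite dimensions $d_A\le d_B$, with canonical bases $\{G^A_\alpha\}_{\alpha=0}^{d_A^2-1}$ of $\mathcal{B}(\mathcal{H}_A)$ and $\{G^B_\beta\}_{\beta=0}^{d_B^2-1}$ of $\mathcal{B}(\mathcal{H}_B)$. Let $x,y\ge 0$ be real and let $O=(O^{\alpha\beta})$ be an arbitrary real $d_A^2\times d_B^2$ isometry matrix. Define the operator on $\mathcal{H}_A\otimes\mathcal{H}_B$ $$W^{xy}_O=\mathcal{N}_A(x)\,\mathcal{N}_B(y)\,\mathbb{1}_A\otimes\mathbb{1}_B+\sum_{\alpha=0}^{d_A^2-1}\sum_{\beta=0}^{d_B^2-1}(D^A_x)_{\alpha\alpha}\,O^{\alpha\beta}\,(D^B_y)_{\beta\beta}\;G^A_\alpha\otimes G^B_\beta,$$ where $\mathcal{N}_A(x)=\sqrt{(d_A-1+x^2)/d_A}$ and $\mathcal{N}_B(y)=\sqrt{(d_B-1+y^2)/d_B}$. Then $\mathrm{Tr}(W^{xy}_O\,\rho)\ge 0$ for every separable density operator $\rho$ on $\mathcal{H}_A\otimes\mathcal{H}_B$.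
   Context: A density operator is a positive semidefinite operator of trace one. A density operator $\rho$ on $\mathcal{H}_A\otimes\mathcal{H}_B$ is separable if $\rho=\sum_k p_k\,\rho^A_k\otimes\rho^B_k$ (a finite sum) with $(p_k)$ a probability distribution and $\rho^A_k,\rho^B_k$ density operators on $\mathcal{H}_A,\mathcal{H}_B$. A canonical basis of $\mathcal{B}(\mathcal{H})$ (with $\dim\mathcal{H}=d$) is a basis $\{G_\alpha\}_{\alpha=0}^{d^2-1}$ of Hermitian operators, orthonormal for the Hilbert-Schmidt inner product $\langle X|Y\rangle_{\rm HS}=\mathrm{Tr}(X^\dagger Y)$, with $G_0=\mathbb{1}/\sqrt{d}$. $D^A_x=\mathrm{diag}\{x,1,\dots,1\}$ is the $d_A^2\times d_A^2$ diagonal matrix, and $D^B_y=\mathrm{diag}\{y,1,\dots,1\}$ is the $d_B^2\times d_B^2$ diagonal matrix (the first entry corresponds to index $0$). Since $d_A\le d_B$, a real $d_A^2\times d_B^2$ isometry matrix means a real matrix $O$ with $OO^{T}=\mathbb{1}$ (all singular values equal to $1$). *)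

(* Defs.v *)
From HB Require Import structures.
From mathcomp Require Import all_boot all_order all_algebra.
From mathcomp Require Import reals complex mxtens.

Set Implicit Arguments.
Unset Strict Implicit.
Unset Printing Implicit Defensive.

Import Order.TTheory GRing.Theory Num.Theory.
Local Open Scope ring_scope.
Local Open Scope complex_scope.
Local Open Scope sesquilinear_scope.

(* Scalars are the complex numbers R[i] over a realType R.
   A d-dimensional Hilbert space is C^d, its operators are the d x d matrices
   in an orthonormal basis, and the tensor product of operators is the Kronecker
   product [*t], acting on C^(dA * dB). *)

(* The order of R[i] is partial: [0 <= z] means that z is real and nonnegative,
   so, the field being complex, [psd A] forces A to be Hermitian. *)
Definition psd (R : realType) (d : nat) (A : 'M[R[i]]_d) : Prop :=
  forall v : 'cV[R[i]]_d, 0 <= (v^t* *m A *m v) 0 0.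

Definition density (R : realType) (d : nat) (rho : 'M[R[i]]_d) : Prop :=
  psd rho /\ \tr rho = 1.

Definition separable (R : realType) (dA dB : nat)
    (rho : 'M[R[i]]_(dA * dB)) : Prop :=
  density rho /\
  exists (n : nat) (p : 'I_n -> R)
         (rhoA : 'I_n -> 'M[R[i]]_dA) (rhoB : 'I_n -> 'M[R[i]]_dB),
    [/\ forall k, 0 <= p k,
        \sum_k p k = 1,
        forall k, density (rhoA k),
        forall k, density (rhoB k)
      & rho = \sum_k (p k)%:C *: (rhoA k *t rhoB k)].

Definition hs_dot (R : realType) (d : nat) (X Y : 'M[R[i]]_d) : R[i] :=
  \tr (X^t* *m Y).

Definition canonical_basis (R : realType) (d : nat)
    (G : 'I_(d ^ 2) -> 'M[R[i]]_d) : Prop :=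
  [/\ basis_of {: 'M[R[i]]_d} (codom G),
      forall a, G a \is hermsymmx,
      forall a b, hs_dot (G a) (G b) = (a == b)%:R
    & forall a : 'I_(d ^ 2), a = 0%N :> nat -> G a = ((Num.sqrt d%:R)^-1)%:C *: 1%:M].

(* diag{x, 1, ..., 1}, of size d^2 *)
Definition Dmx (R : realType) (d : nat) (x : R) : 'M[R]_(d ^ 2) :=
  diag_mx (\row_(a < d ^ 2) (if a == 0%N :> nat then x else 1)).

Definition Nfactor (R : realType) (d : nat) (x : R) : R :=
  Num.sqrt ((d%:R - 1 + x ^+ 2) / d%:R).

Definition W (R : realType) (dA dB : nat)
    (GA : 'I_(dA ^ 2) -> 'M[R[i]]_dA) (GB : 'I_(dB ^ 2) -> 'M[R[i]]_dB)
    (x y : R) (O : 'M[R]_(dA ^ 2, dB ^ 2)) : 'M[R[i]]_(dA * dB) :=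
  (Nfactor dA x * Nfactor dB y)%:C *: ((1%:M : 'M_dA) *t (1%:M : 'M_dB))
  + \sum_(a < dA ^ 2) \sum_(b < dB ^ 2)
      (Dmx dA x a a * O a b * Dmx dB y b b)%:C *: (GA a *t GB b).

(* Main.v *)
Require Import Defs.
From HB Require Import structures.
From mathcomp Require Import all_boot all_order all_algebra.
From mathcomp Require Import reals complex mxtens.
From mathcomp Require Import ring lra.

Set Implicit Arguments.
Unset Strict Implicit.
Unset Printing Implicit Defensive.

Import Order.TTheory GRing.Theory Num.Theory.
Local Open Scope ring_scope.

(** By linearity it is enough to treat a product state.  Its Bloch coordinates
    [r a = tr (GA a rhoA)] and [s b = tr (GB b rhoB)] are real, and Bessel's
    inequality together with the purity bound [tr (rho ^ 2) <= 1] and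
    [r 0 = 1 / sqrt d] gives [|D_x r| <= N_A(x)] and [|D_y s| <= N_B(y)].
    Since [O] has operator norm 1, Cauchy-Schwarz yields
    [<D_x r, O D_y s> >= - N_A(x) N_B(y)]. *)

(** Cauchy-Schwarz in a one-sided form that avoids square roots, hence valid over any real field. A
    zero bound makes the corresponding vector vanish, which lets the main case cancel the factor
    [2ab]. *)
Lemma sum_mulr_ge_opp (R : realFieldType) (n : nat) (t w : 'I_n -> R) (a b : R) :
  0 <= a -> 0 <= b -> \sum_j t j ^+ 2 <= a ^+ 2 -> \sum_j w j ^+ 2 <= b ^+ 2 ->
  0 <= a * b + \sum_j t j * w j.
Proof.
move=> a0 b0 ta wb.
have null u : \sum_(j < n) u j ^+ 2 <= (0 : R) -> forall j, u j = 0.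
  move=> hu j; apply/eqP; rewrite -sqrf_eq0; apply/eqP.
  have /eqP : \sum_(j < n) u j ^+ 2 = 0.
    by apply/le_anti; rewrite hu sumr_ge0 // => i _; apply: sqr_ge0.
  rewrite psumr_eq0 => [/allP/(_ j)|i _]; last exact: sqr_ge0.
  by rewrite mem_index_enum => /(_ isT)/eqP.
have [a_eq0|a_neq0] := eqVneq a 0.
  rewrite a_eq0 expr0n /= in ta.
  by rewrite a_eq0 mul0r add0r big1 // => j _; rewrite (null _ ta) mul0r.
have [b_eq0|b_neq0] := eqVneq b 0.
  rewrite b_eq0 expr0n /= in wb.
  by rewrite b_eq0 mulr0 add0r big1 // => j _; rewrite (null _ wb) mulr0.
have a_gt0 : 0 < a by rewrite lt0r a_neq0.
have b_gt0 : 0 < b by rewrite lt0r b_neq0.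
(* The weights [b] and [a] balance the two norms: after expansion, each square term is at most
   [a^2 b^2], so the sum is at most [2ab (ab + \sum_j t j * w j)]. *)
have : 0 <= \sum_j (b * t j + a * w j) ^+ 2.
  by apply: sumr_ge0 => j _; apply: sqr_ge0.
rewrite (eq_bigr (fun j => b ^+ 2 * t j ^+ 2 + a * b *+ 2 * (t j * w j)
                         + a ^+ 2 * w j ^+ 2)); last by move=> j _; ring.
rewrite !big_split /= -!mulr_sumr => sq.
have ub : 0 <= a * b *+ 2 * (a * b + \sum_j t j * w j).
  apply: le_trans sq _.
  have h1 := ler_wpM2l (sqr_ge0 b) ta; have h2 := ler_wpM2l (sqr_ge0 a) wb.
  by nra.
by rewrite pmulr_rge0 // in ub; rewrite mulrn_wgt0 // mulr_gt0.
Qed.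

(** Since [O O^T = 1], the vectors [O^T u] and [u] have the same norm, so Cauchy-Schwarz applies to
    [O^T u] and [w]. *)
Lemma isometry_form_ge_opp (R : realFieldType) (m n : nat) (O : 'M[R]_(m, n))
    (u : 'I_m -> R) (w : 'I_n -> R) (a b : R) :
  O *m O^T = 1%:M -> 0 <= a -> 0 <= b ->
  \sum_i u i ^+ 2 <= a ^+ 2 -> \sum_j w j ^+ 2 <= b ^+ 2 ->
  0 <= a * b + \sum_i \sum_j u i * O i j * w j.
Proof.
move=> OO a0 b0 ua wb; rewrite exchange_big /=.
under eq_bigr do rewrite -mulr_suml.
apply: sum_mulr_ge_opp => //; apply: le_trans ua.
pose v : 'rV[R]_m := \row_i u i.
have -> : \sum_i u i ^+ 2 = (v *m v^T) 0 0.
  by rewrite mxE; apply: eq_bigr => i _; rewrite !mxE expr2.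
rewrite -[v in v *m _]mulmx1 -OO mulmxA -mulmxA -trmx_mul mxE.
rewrite le_eqVlt; apply/orP; left; apply/eqP/eq_bigr => j _.
rewrite !mxE -expr2; congr (_ ^+ 2).
by apply: eq_bigr => i _; rewrite !mxE.
Qed.

(** The hypothesis is positivity of the quadratic form of the 2 x 2 matrix with rows [(p, z)] and
    [(w, q)]; the conclusion is its Hermitian symmetry and the sign of its determinant. *)
Lemma hermitian2_psd (C : numClosedFieldType) (p q z w : C) :
  (forall a b : C, 0 <= a^* * a * p + a^* * b * z + b^* * a * w + b^* * b * q) ->
  w = z^* /\ z^* * z <= p * q.
Proof.
move=> form_ge0.
have p_ge0 : 0 <= p.
  by have := form_ge0 1 0; rewrite conjC0 conjC1 !(mul0r, mulr0, addr0, mul1r).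
have q_ge0 : 0 <= q.
  by have := form_ge0 0 1; rewrite conjC0 conjC1 !(mul0r, mulr0, addr0, mul1r, add0r).
have pJ : p^* = p by apply/CrealP/ger0_real.
have qJ : q^* = q by apply/CrealP/ger0_real.
have wE : w = z^*.
  (* Reality of the form at [(1, 1)] and at [(1, 'i)] gives two linear relations whose sum is
     [2 w^* = 2 z]. *)
  have /ger0_real/CrealP e1 := form_ge0 1 1.
  have /ger0_real/CrealP e2 := form_ge0 1 'i.
  move: e1 e2; rewrite !(rmorphD, rmorphM, rmorph1) /= !conjCK pJ qJ !conjCi.
  rewrite !mul1r => e1 e2.
  have {}e1 : z^* + w^* = z + w.
    by move/(congr1 (fun t => t - p - q)): e1; congr (_ = _); ring.
  have {}e2 : 'i * (w^* - z^*) = 'i * (z - w).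
    by move/(congr1 (fun t => t - p + 'i * 'i * q)): e2; congr (_ = _); ring.
  move/(mulfI (neq0Ci _)): e2 => e2.
  apply: (can_inj (@conjCK C)); rewrite conjCK.
  have /eqP : w^* *+ 2 = z *+ 2.
    by have := congr2 +%R e1 e2; congr (_ = _); ring.
  by rewrite eqrMn2r => /eqP.
(* For [q > 0] the form is evaluated at its minimizer [(q, - z^* )]; symmetrically
   for [p > 0], and [p = q = 0] forces [z = 0]. *)
split=> //; rewrite {}wE in form_ge0.
have disc r s : 0 < s -> 0 <= s * (s * r - z^* * z) -> z^* * z <= r * s.
  by move=> s_gt0; rewrite pmulr_rge0 // subr_ge0 (mulrC s).
have [q_gt0|] := boolP (0 < q).
  apply: disc => //; have := form_ge0 q (- z^*).
  by rewrite !(rmorphN, conjCK) qJ; congr (0 <= _); ring.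
have [p_gt0 _|] := boolP (0 < p).
  rewrite (mulrC p); apply: disc => //; have := form_ge0 (- z) p.
  by rewrite !(rmorphN, conjCK) pJ; congr (0 <= _); ring.
rewrite !lt0r p_ge0 q_ge0 !andbT !negbK => /eqP p0 /eqP q0.
have := form_ge0 1 (- z^*).
rewrite p0 q0 conjC1 rmorphN /= conjCK !(mulr0, mul1r, add0r, addr0, mulr1).
by rewrite mulNr mulNr mulrC -mulr2n mulNrn oppr_ge0 pmulrn_lle0.
Qed.

Local Open Scope sesquilinear_scope.

(** Restricting the form to the vectors [a e_i + b e_j] reduces to the 2 x 2 case. *)
Lemma psd_entry (C : numClosedFieldType) (d : nat) (A : 'M[C]_d) :
  (forall v : 'cV[C]_d, 0 <= (v^t* *m A *m v) 0 0) ->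
  forall i j, A j i = (A i j)^* /\ (A i j)^* * A i j <= A i i * A j j.
Proof.
move=> psdA i j; apply: hermitian2_psd => a b.
have := psdA (a *: delta_mx i 0 + b *: delta_mx j 0).
congr (0 <= _).
have -> : (a *: delta_mx i 0 + b *: delta_mx j 0)^t*
    = a^* *: delta_mx 0 i + b^* *: delta_mx 0 j :> 'rV[C]_d.
  by rewrite linearD !linearZ /= !trmx_delta map_mxD !map_mxZ !map_delta_mx.
rewrite !mulmxDl !mulmxDr -!scalemxAl -!rowE -!scalemxAr -!colE !mxE.
by ring.
Qed.

Lemma psd_trmxC (C : numClosedFieldType) (d : nat) (A : 'M[C]_d) :
  (forall v : 'cV[C]_d, 0 <= (v^t* *m A *m v) 0 0) -> A^t* = A.
Proof.
by move=> psdA; apply/matrixP => i j; rewrite !mxE; case: (psd_entry psdA j i).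
Qed.

(** The purity bound, obtained without diagonalisation: summing [|A i j|^2 <= A i i * A j j] over
    all entries makes the right-hand side factor as the squared trace. *)
Lemma psd_hs_norm_le (C : numClosedFieldType) (d : nat) (A : 'M[C]_d) :
  (forall v : 'cV[C]_d, 0 <= (v^t* *m A *m v) 0 0) ->
  \tr (A^t* *m A) <= \tr A ^+ 2.
Proof.
move=> psdA; rewrite expr2 mulr_suml; apply: ler_sum => i _.
rewrite mulr_sumr mxE; apply: ler_sum => j _.
by rewrite !mxE mulrC [A i i * _]mulrC mulrC; case: (psd_entry psdA j i).
Qed.

Lemma hs_norm_ge0 (C : numClosedFieldType) (m n : nat) (Y : 'M[C]_(m, n)) :
  0 <= \tr (Y^t* *m Y).
Proof.
apply: sumr_ge0 => i _; rewrite mxE; apply: sumr_ge0 => j _.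
by rewrite !mxE mulrC mul_conjC_ge0.
Qed.

Lemma hs_dotC (C : numClosedFieldType) (m n : nat) (X Y : 'M[C]_(m, n)) :
  \tr (X^t* *m Y) = (\tr (Y^t* *m X))^*.
Proof.
rewrite rmorph_sum; apply: eq_bigr => i _ /=.
rewrite !mxE rmorph_sum; apply: eq_bigr => j _.
by rewrite !mxE rmorphM /= conjCK mulrC.
Qed.

(** With [Z] the orthogonal projection of [X] onto the span of [G], the squared norm of [X - Z] is
    that of [X] minus the sum of the squared coefficients. *)
Lemma hs_bessel (C : numClosedFieldType) (d n : nat) (G : 'I_n -> 'M[C]_d)
    (X : 'M[C]_d) :
  (forall a b, \tr ((G a)^t* *m G b) = (a == b)%:R) ->
  \sum_a (\tr ((G a)^t* *m X))^* * \tr ((G a)^t* *m X) <= \tr (X^t* *m X).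
Proof.
move=> orthoG; set c := fun a => \tr ((G a)^t* *m X).
pose Z := \sum_a c a *: G a.
have GZ a : \tr ((G a)^t* *m Z) = c a.
  rewrite mulmx_sumr raddf_sum (bigD1 a) //= big1 => [|b ba].
    by rewrite addr0 -scalemxAr mxtraceZ orthoG eqxx mulr1.
  by rewrite -scalemxAr mxtraceZ orthoG eq_sym (negbTE ba) mulr0.
have Z_dot Y : \tr (Z^t* *m Y) = \sum_a (c a)^* * \tr ((G a)^t* *m Y).
  rewrite /Z linear_sum map_mx_sum mulmx_suml raddf_sum; apply: eq_bigr => a _.
  by rewrite /= linearZ map_mxZ -scalemxAl mxtraceZ.
have ZZ : \tr (Z^t* *m Z) = \sum_a (c a)^* * c a.
  by rewrite Z_dot; apply: eq_bigr => a _; rewrite GZ.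
have XZ : \tr (X^t* *m Z) = \sum_a (c a)^* * c a.
  rewrite mulmx_sumr raddf_sum; apply: eq_bigr => a _.
  by rewrite -scalemxAr /= mxtraceZ hs_dotC mulrC.
have := hs_norm_ge0 (X - Z).
have -> : (X - Z)^t* = X^t* - Z^t* by rewrite linearB map_mxB.
rewrite mulmxBl !mulmxBr !linearB /= ZZ XZ Z_dot -/c.
by rewrite subrr subr0 subr_ge0.
Qed.

Local Open Scope complex_scope.

Lemma mxtrace_tens (R : comPzRingType) (m n : nat) (A : 'M[R]_m) (B : 'M[R]_n) :
  \tr (A *t B) = \tr A * \tr B.
Proof. by rewrite [RHS]mulr_sum; apply: eq_bigr => i _; rewrite mxE. Qed.

Lemma density_coord_norm (R : realType) (d : nat) (G : 'I_(d ^ 2) -> 'M[R[i]]_d)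
    (rho : 'M[R[i]]_d) (x : R) :
  canonical_basis G -> density rho ->
  exists2 r : 'I_(d ^ 2) -> R, forall a, \tr (G a *m rho) = (r a)%:C
    & \sum_a (Dmx d x a a * r a) ^+ 2 <= Nfactor d x ^+ 2.
Proof.
move=> [_ Gherm Gortho G0] [psd_rho tr_rho].
(* In dimension zero the trace would be 0 instead of 1. *)
have d_gt0 : (0 < d)%N.
  case: d G rho Gherm Gortho G0 psd_rho tr_rho => // G rho _ _ _ _.
  by rewrite /mxtrace big_ord0 => /esym/eqP; rewrite oner_eq0.
have rhoJ : rho^t* = rho := psd_trmxC psd_rho.
have GJ a : (G a)^t* = G a.
  by have /is_hermitianmxP := Gherm a; rewrite expr0 scale1r => <-.
pose r a := complex.Re (\tr (G a *m rho)).
have rE a : \tr (G a *m rho) = (r a)%:C.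
  (* Both matrices are Hermitian, so conjugation only swaps the two factors under the trace. *)
  apply/esym/RRe_real/CrealP.
  by have := hs_dotC rho (G a); rewrite rhoJ GJ mxtrace_mulC => <-.
exists r => //.
have r_le1 : \sum_a r a ^+ 2 <= 1.
  have : \sum_a (r a ^+ 2)%:C <= 1 :> R[i].
    have := le_trans (hs_bessel rho Gortho) (psd_hs_norm_le psd_rho).
    rewrite tr_rho expr1n; congr (_ <= _); apply: eq_bigr => a _.
    rewrite GJ rE rmorphXn expr2; congr (_ * _).
    by apply/CrealP/complex_realP; exists (r a).
  by rewrite -rmorph_sum -(rmorph1 (real_complex R)) lecR.
have d2_gt0 : (0 < d ^ 2)%N by rewrite expn_gt0 d_gt0.
pose a0 := Ordinal d2_gt0.
have r0 : r a0 = (Num.sqrt d%:R)^-1.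
  apply: complexI; rewrite -rE G0 // -scalemxAl mul1mx mxtraceZ tr_rho.
  by rewrite mulr1.
have r0sq : r a0 ^+ 2 = d%:R^-1 by rewrite r0 exprVn sqr_sqrtr ?ler0n.
have dR_gt0 : 0 < d%:R :> R by rewrite ltr0n.
have d_ge1 : 1 <= d%:R :> R by rewrite ler1n.
(* Only coordinate 0 is reweighted, and [r a0 ^+ 2 = 1/d]; with [r_le1] the bound becomes
   [1 + (x^2 - 1)/d], which is exactly [Nfactor d x ^+ 2]. *)
have -> : \sum_a (Dmx d x a a * r a) ^+ 2
    = \sum_a r a ^+ 2 + (x ^+ 2 - 1) * r a0 ^+ 2.
  rewrite (bigD1 a0) //= [in RHS](bigD1 a0) //= !mxE !eqxx mulr1n.
  rewrite (eq_bigr (fun a => r a ^+ 2)) => [|a].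
    by rewrite exprMn; ring.
  by rewrite -val_eqE /= !mxE eqxx mulr1n => /negbTE->; rewrite mul1r.
rewrite sqr_sqrtr; last first.
  by rewrite divr_ge0 ?ler0n // addr_ge0 ?sqr_ge0 // subr_ge0.
apply: (le_trans (lerD r_le1 (lexx _))); rewrite r0sq.
rewrite le_eqVlt; apply/orP; left; apply/eqP; field.
by rewrite gt_eqF.
Qed.

Theorem mainTheorem3 (R : realType) (dA dB : nat) (hd : (dA <= dB)%N)
    (GA : 'I_(dA ^ 2) -> 'M[R[i]]_dA) (hGA : canonical_basis GA)
    (GB : 'I_(dB ^ 2) -> 'M[R[i]]_dB) (hGB : canonical_basis GB)
    (x y : R) (hx : 0 <= x) (hy : 0 <= y)
    (O : 'M[R]_(dA ^ 2, dB ^ 2)) (hO : O *m O^T = 1%:M)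
    (rho : 'M[R[i]]_(dA * dB)) (hrho : separable rho) :
  0 <= \tr (W GA GB x y O *m rho).
Proof.
case: hrho => _ [n [p [rhoA [rhoB [p_ge0 _ densA densB ->]]]]].
rewrite mulmx_sumr raddf_sum; apply: sumr_ge0 => k _ /=.
rewrite -scalemxAr mxtraceZ mulr_ge0 ?ler0c ?p_ge0 //.
have [r rE r_le] := density_coord_norm x hGA (densA k).
have [s sE s_le] := density_coord_norm y hGB (densB k).
rewrite /W mulmxDl mxtraceD -scalemxAl mxtraceZ tensmx_mul !mul1mx mxtrace_tens.
have [_ ->] := densA k; have [_ ->] := densB k; rewrite !mulr1.
rewrite mulmx_suml raddf_sum.
(* Each trace factors over the tensor product into real coordinates; the diagonal weights are
   absorbed into [r] and [s], leaving the bilinear form of [O] alone. *)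
rewrite (eq_bigr (fun a => (\sum_b (Dmx dA x a a * r a) * O a b
                                    * (Dmx dB y b b * s b))%:C)) => [|a _].
  rewrite -rmorph_sum -rmorphD /= ler0c.
  by apply: isometry_form_ge_opp; rewrite ?sqrtr_ge0.
rewrite rmorph_sum /= mulmx_suml raddf_sum; apply: eq_bigr => b _ /=.
rewrite -scalemxAl mxtraceZ tensmx_mul mxtrace_tens rE sE -!rmorphM /=.
by congr (_%:C); ring.
Qed.
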